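(* Let $w_1,w_2,w_3$ be any positive integers, let $n\ge 0$ be an integer and let $y\in\mathbb{Z}_p$. Then \begin{align*} &\sum_{k+l+m=n}\binom{n}{k,l,m}E_{k,q^{w_3}}(w_1y)E_{l,q^{w_1}}(w_2y)E_{m,q^{w_2}}(w_3y)\,w_3^{k}w_1^{l}w_2^{m}\\ =&\sum_{k+l+m=n}\binom{n}{k,l,m}E_{k,q^{w_2}}(w_1y)E_{l,q^{w_1}}(w_3y)E_{m,q^{w_3}}(w_2y)\,w_2^{k}w_1^{l}w_3^{m}. \end{align*}
   Context: Let $p$ be a fixed odd prime, $\mathbb{C}_p$ the completion of an algebraic closure of $\mathbb{Q}_p$ with absolute value normalized by $|p|_p=1/p$, and let $q\in\mathbb{C}_p$ be fixed with $|q-1|_p<p^{-1/(p-1)}$. For $r\in\mathbb{C}_p$ with $|r-1|_p<p^{-1/(p-1)}$ (in particular for $r=q^w$, $w$ a positive integer), the $r$-Euler polynomials $E_{n,r}(x)$ ($n\ge 0$) are the polynomials in $x$ defined by the generating function $$\frac{2}{re^{t}+1}e^{xt}=\sum_{n=0}^{\infty}E_{n,r}(x)\frac{t^n}{n!}.$$ Sums over $k+l+m=n$ run over all nonnegative integers $k,l,m$ with $k+l+m=n$, and $\binom{n}{k,l,m}=\frac{n!}{k!\,l!\,m!}$. *)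

(* Defs.v *)
From HB Require Import structures.
From mathcomp Require Import all_boot all_order all_algebra.
From mathcomp Require Import reals exp.

Set Implicit Arguments.
Unset Strict Implicit.
Unset Printing Implicit Defensive.

Import Order.TTheory GRing.Theory Num.Theory.
Local Open Scope ring_scope.

(* A formal power series sum_n f_n t^n over A is its coefficient sequence
   f : nat -> A.  Series are compared coefficientwise. *)
Section PowerSeries.
Variable A : comUnitRingType.
Implicit Types f g h : nat -> A.

Definition constS (a : A) : nat -> A := fun n => if n is 0 then a else 0.

Definition addS f g : nat -> A := fun n => f n + g n.

Definition mulS f g : nat -> A := fun n => \sum_(i < n.+1) f i * g (n - i)%N.

(* [:: g_0; ...; g_(n-1)] where g = 1/f is computed by the recursion
   f_0 g_m = [m = 0] - sum_(i < m) f_(m-i) g_i. *)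
Fixpoint invS_prefix f (n : nat) : seq A :=
  if n is m.+1 then
    let s := invS_prefix f m in
    rcons s ((f 0%N)^-1 * ((m == 0)%:R - \sum_(i < m) f (m - i)%N * s`_i))
  else [::].

Definition invS f : nat -> A := fun n => (invS_prefix f n.+1)`_n.

Definition divS f g : nat -> A := mulS f (invS g).

(* the series e^(a t) *)
Definition expS (a : A) : nat -> A := fun n => a ^+ n / n`!%:R.

Lemma size_invS_prefix f n : size (invS_prefix f n) = n.
Proof. by elim: n => //= n IHn; rewrite size_rcons IHn. Qed.

Lemma nth_invS_prefix f n i : (i < n)%N -> (invS_prefix f n)`_i = invS f i.
Proof.
elim: n => // n IHn; rewrite ltnS leq_eqVlt => /predU1P[->//|lt_in].
by rewrite /= nth_rcons size_invS_prefix lt_in IHn.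
Qed.

Lemma invSE f n :
  invS f n =
    (f 0%N)^-1 * ((n == 0)%:R - \sum_(i < n) f (n - i)%N * invS f i).
Proof.
rewrite {1}/invS /= nth_rcons size_invS_prefix ltnn eqxx.
by congr (_ * (_ - _)); apply: eq_bigr => i _; rewrite nth_invS_prefix.
Qed.

Lemma mulSC f g n : mulS f g n = mulS g f n.
Proof.
rewrite /mulS (reindex_inj rev_ord_inj) /=; apply: eq_bigr => i _.
by rewrite subSS subKn 1?mulrC // -ltnS.
Qed.

Lemma mulS_invS f n : f 0%N \is a GRing.unit -> mulS f (invS f) n = constS 1 n.
Proof.
move=> Uf; rewrite mulSC /mulS big_ord_recr /= subnn [invS f n]invSE.
rewrite [_ * f 0%N]mulrC mulVKr // addrC.
rewrite (eq_bigr _ (fun (i : 'I_n) _ => mulrC (invS f i) (f (n - i)%N))).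
by rewrite subrK; case: n.
Qed.

Lemma mulSA f g h n : mulS f (mulS g h) n = mulS (mulS f g) h n.
Proof.
pose P u := \poly_(i < n.+1) (u i : A).
have PE u i : (i <= n)%N -> (P u)`_i = u i by move=> ?; rewrite coef_poly ltnS ifT.
have PM u v i : (i <= n)%N -> (P u * P v)`_i = mulS u v i.
  move=> le_in; rewrite coefM; apply: eq_bigr => -[j /= ltj] _.
  by rewrite !PE // ?(leq_trans (leq_subr _ _)) // (leq_trans _ le_in).
transitivity ((P f * (P g * P h))`_n); last rewrite mulrA.
  rewrite coefM; apply: eq_bigr => -[j /= ltj] _.
  by rewrite PE // PM // leq_subr.
by rewrite coefM; apply: eq_bigr => -[j /= ltj] _; rewrite PE ?PM ?leq_subr.
Qed.

Lemma eq_mulS f f' g g' : f =1 f' -> g =1 g' -> mulS f g =1 mulS f' g'.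
Proof. by move=> ef eg n; apply: eq_bigr => i _; rewrite ef eg. Qed.

Lemma mul1S f : mulS (constS 1) f =1 f.
Proof.
move=> n; rewrite /mulS big_ord_recl /= mul1r subn0 big1 ?addr0 // => i _.
by rewrite mul0r.
Qed.

End PowerSeries.

Section Euler.
Variable K : fieldType.

(* the series 2 / (r e^t + 1) * e^(x t) in K[x][[t]], with x = 'X *)
Definition Euler_series (r : K) : nat -> {poly K} :=
  mulS (divS (constS 2) (addS (mulS (constS r%:P) (expS 1)) (constS 1)))
       (expS 'X).

Definition Euler_poly (r : K) (n : nat) : {poly K} :=
  n`!%:R * Euler_series r n.

(* The defining identity: sum_n E_(n,r)(x) t^n/n! * (r e^t + 1) = 2 e^(x t). *)
Lemma Euler_polyP (r : K) (n : nat) :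
    [pchar K] =i pred0 -> r + 1 != 0 ->
  mulS (addS (mulS (constS r%:P) (expS 1)) (constS 1))
       (fun k => Euler_poly r k / k`!%:R) n
  = mulS (constS 2) (expS 'X) n.
Proof.
move=> charK r1; set d := addS _ _.
have Ud : d 0%N \is a GRing.unit.
  rewrite /d /addS /mulS big_ord1 /= /expS expr0 divr1 mulr1 -polyCD.
  by rewrite poly_unitE size_polyC coefC r1 /= unitfE.
have UN k : (k`!%:R : {poly K}) \is a GRing.unit.
  have ->: k`!%:R = (k`!%:R : K)%:P by rewrite raddfMn.
  have kN0 : (k`!%:R : K) != 0 by rewrite ((pcharf0P K).1 charK) -lt0n fact_gt0.
  by rewrite poly_unitE size_polyC coefC kN0 /= unitfE.
have eqE : (fun k => Euler_poly r k / k`!%:R) =1 Euler_series r.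
  by move=> k; rewrite /Euler_poly mulrC mulKr.
rewrite (eq_mulS (frefl d) eqE) /Euler_series /divS -/d mulSA.
apply: eq_mulS => // k; rewrite mulSC -mulSA.
rewrite (eq_mulS (frefl _) (_ : _ =1 constS 1)) 1?mulSC ?mul1S // => j.
by rewrite mulSC mulS_invS.
Qed.

End Euler.

Section ValuedFields.
Variable R : realType.

Record is_absolute_value (K : fieldType) (v : K -> R) : Prop := {
  absv_ge0 : forall x, 0 <= v x;
  absv_eq0 : forall x, v x = 0 <-> x = 0;
  absvM : forall x y, v (x * y) = v x * v y;
  absvD : forall x y, v (x + y) <= v x + v y }.

Definition complete_absv (K : fieldType) (v : K -> R) : Prop :=
  forall u : nat -> K,
    (forall e : R, 0 < e -> exists N : nat,
       forall m n, (N <= m)%N -> (N <= n)%N -> v (u m - u n) < e) ->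
  exists l : K, forall e : R, 0 < e -> exists N : nat,
    forall n, (N <= n)%N -> v (u n - l) < e.

Record is_completion (K L : fieldType) (v : K -> R) (w : L -> R)
    (i : {rmorphism K -> L}) : Prop := {
  completion_absv : is_absolute_value w;
  completion_isometry : forall x, w (i x) = v x;
  completion_complete : complete_absv w;
  completion_dense : forall (z : L) (e : R), 0 < e -> exists x, w (z - i x) < e }.

Record is_algebraic_closure (K L : fieldType) (i : {rmorphism K -> L}) : Prop := {
  algclosure_closed : GRing.closed_field_axiom L;
  algclosure_algebraic : forall z : L, algebraicOver i z }.

Definition padic_abs (p : nat) (x : rat) : R :=
  if x == 0 then 0
  else p%:R ^+ logn p `|denq x|%N / p%:R ^+ logn p `|numq x|%N.

End ValuedFields.

(* A tower Q -> Q_p -> Qpbar -> C_p: the completion C_p of an algebraic closure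
   Qpbar of the completion Q_p of Q at p, with compatible absolute values.  The
   compatibility with padic_abs gives the normalization |p| = 1/p.  Such a tower
   exists for each prime p and is unique up to isometric isomorphism. *)
Record padic_complex (R : realType) (p : nat) := PadicComplex {
  Qp : fieldType;
  Qp_abs : Qp -> R;
  rat_Qp : {rmorphism rat -> Qp};
  Qp_completion : is_completion (padic_abs R p) Qp_abs rat_Qp;
  Qpbar : fieldType;
  Qpbar_abs : Qpbar -> R;
  Qp_Qpbar : {rmorphism Qp -> Qpbar};
  Qpbar_algclosure : is_algebraic_closure Qp_Qpbar;
  Qpbar_absv : is_absolute_value Qpbar_abs;
  Qpbar_isometry : forall x, Qpbar_abs (Qp_Qpbar x) = Qp_abs x;
  Cp : fieldType;
  Cp_abs : Cp -> R;
  Qpbar_Cp : {rmorphism Qpbar -> Cp};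
  Cp_completion : is_completion Qpbar_abs Cp_abs Qpbar_Cp }.

Definition Qp_Cp (R : realType) (p : nat) (C : padic_complex R p) (y : Qp C) :
  Cp C := Qpbar_Cp C (Qp_Qpbar C y).

(* the ring of integers Z_p of Q_p *)
Definition in_Zp (R : realType) (p : nat) (C : padic_complex R p) (y : Qp C) :
  Prop := Qp_abs y <= 1.

(* Main.v *)
(** The triple sum is n! times the t^n-coefficient of the product of the three
    series 2 / (q^w e^(w t) + 1) e^(x w t), with (w, x) running over
    (w3, w1 y), (w1, w2 y), (w2, w3 y).  Gathering the exponentials, the product
    is (prod_i 2 / (q^(w_i) e^(w_i t) + 1)) e^((w1 w2 + w2 w3 + w3 w1) y t), which is
    symmetric in w1, w2, w3. *)
Require Import Defs.
From HB Require Import structures.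
From mathcomp Require Import all_boot all_order all_algebra.
From mathcomp Require Import reals exp ring.

Set Implicit Arguments.
Unset Strict Implicit.
Unset Printing Implicit Defensive.

Import Order.TTheory GRing.Theory Num.Theory.
Local Open Scope ring_scope.

Section PowerSeriesTheory.
Variable A : comUnitRingType.
Implicit Types f g h : nat -> A.

(** The substitution of [a t] for [t]; it absorbs the powers of the weights in the triple sum into a
    change of variable. *)
Definition dilS (a : A) f : nat -> A := fun n => a ^+ n * f n.

Lemma dilSM a f g : dilS a (mulS f g) =1 mulS (dilS a f) (dilS a g).
Proof.
move=> n; rewrite /dilS /mulS mulr_sumr; apply: eq_bigr => -[i /= lt_in] _.
by rewrite mulrACA -exprD subnKC.
Qed.

Lemma dilS_expS (a b : A) : dilS a (expS b) =1 expS (a * b).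
Proof. by move=> n; rewrite /dilS /expS exprMn mulrA. Qed.

Lemma eq_invS f g : f =1 g -> invS f =1 invS g.
Proof.
move=> eq_fg; elim/ltn_ind => n IHn; rewrite !invSE eq_fg.
by congr (_ * (_ - _)); apply: eq_bigr => i _; rewrite IHn ?eq_fg.
Qed.

Lemma mulSACA f g f' g' :
  mulS (mulS f g) (mulS f' g') =1 mulS (mulS f f') (mulS g g').
Proof.
move=> n; rewrite -!mulSA; apply: eq_mulS => // {}n.
by rewrite !mulSA; apply: eq_mulS => // {}n; rewrite mulSC.
Qed.

(** This is the binomial theorem divided by [n!]; invertible factorials make the quotients in [expS]
    genuine rather than default values. *)
Lemma mulS_expS (a b : A) :
    (forall n, (n`!%:R : A) \is a GRing.unit) ->
  mulS (expS a) (expS b) =1 expS (a + b).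
Proof.
move=> Ufact n; rewrite /mulS /expS (addrC a) exprDn mulr_suml; apply: eq_bigr.
move=> -[i /= lt_in] _; have le_in : (i <= n)%N by [].
apply: (mulIr (Ufact n)); rewrite mulrVK // -{1}(bin_fact le_in).
rewrite (natrM _ 'C(n, i)) (natrM _ i`! (n - i)`!) -[RHS]mulr_natr.
transitivity (b ^+ (n - i) * a ^+ i * 'C(n, i)%:R
    * (i`!%:R * i`!%:R^-1) * ((n - i)`!%:R * (n - i)`!%:R^-1)); first by ring.
by rewrite !divrr // !mulr1.
Qed.

(** Once [k] and [l] are chosen, [m] can only be [n - k - l], and the innermost sum is empty when
    [k + l > n]. *)
Lemma mulS3E f g h n :
  \sum_(k < n.+1) \sum_(l < n.+1) \sum_(m < n.+1 | (k + l + m == n)%N)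
     f k * g l * h m
  = mulS f (mulS g h) n.
Proof.
apply: eq_bigr => -[k /= lt_kn] _; have le_kn : (k <= n)%N by [].
(* The range [l <= n - k] is widened to [l <= n] with a guard, to match the left side. *)
rewrite mulr_sumr (big_ord_widen n.+1 (fun l => f k * (g l * h (n - k - l)%N)));
  last by rewrite ltnS leq_subr.
rewrite [RHS]big_mkcond; apply: eq_bigr => -[l /= lt_ln] _.
rewrite ltnS leq_subRL //; case: leqP => [le_kln | lt_nkl].
  have lt_m : (n - k - l < n.+1)%N by rewrite ltnS -subnDA leq_subr.
  rewrite (big_pred1 (Ordinal lt_m)) ?mulrA // => m.
  by rewrite /= -[RHS]val_eqE /= -subnDA -[RHS](eqn_add2l (k + l)) subnKC.
by apply: big1 => m /eqP eq_n; rewrite -eq_n ltnNge leq_addr in lt_nkl.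
Qed.

End PowerSeriesTheory.

Section EulerTheory.
Variable K : fieldType.
Implicit Types (f g : nat -> K) (r x : K).

Lemma polyCV (c : K) : (c%:P)^-1 = (c^-1)%:P.
Proof.
(* At [c = 0] both sides are 0, by the convention for inverses of non-units. *)
have [->|c0] := eqVneq c 0; first by rewrite polyC0 !invr0.
have Uc : (c%:P : {poly K}) \is a GRing.unit.
  by rewrite poly_unitE size_polyC coefC c0 /= unitfE.
by apply: (mulrI Uc); rewrite divrr // -polyCM divff.
Qed.

Lemma mulS_polyC f g n :
  mulS (fun i => (f i)%:P) (fun i => (g i)%:P) n = (mulS f g n)%:P.
Proof. by rewrite /mulS rmorph_sum; apply: eq_bigr => i _; rewrite -polyCM. Qed.

Lemma invS_polyC f n : invS (fun i => (f i)%:P) n = (invS f n)%:P.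
Proof.
elim/ltn_ind: n => n IHn; rewrite !invSE polyCV polyCM polyCB rmorph_sum.
rewrite polyC_natr; congr (_ * (_ - _)).
by apply: eq_bigr => i _; rewrite IHn // -polyCM.
Qed.

Lemma expS_polyC x n : expS x%:P n = (expS x n)%:P.
Proof. by rewrite /expS polyCM rmorphXn /= -polyCV polyC_natr. Qed.

Lemma constS_polyC x n : constS x%:P n = (constS x n)%:P.
Proof. by case: n. Qed.

Lemma horner_mulS (F G : nat -> {poly K}) x n :
  (mulS F G n).[x] = mulS (fun i => (F i).[x]) (fun i => (G i).[x]) n.
Proof. by rewrite /mulS horner_sum; apply: eq_bigr => i _; rewrite hornerM. Qed.

Lemma horner_expSX x n : (expS 'X n).[x] = expS x n.
Proof. by rewrite /expS -polyC_natr polyCV hornerM hornerXn hornerC. Qed.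

(** The generating function at x = 0, with coefficients taken in [K]. *)
Definition Euler_number_series r : nat -> K :=
  divS (constS 2) (addS (mulS (constS r) (expS 1)) (constS 1)).

(** Evaluation at [x] is a ring morphism, and the denominator has constant polynomials as
    coefficients, so its inverse series is already computed in [K]. *)
Lemma horner_Euler_series r x n :
  (Euler_series r n).[x] = mulS (Euler_number_series r) (expS x) n.
Proof.
rewrite horner_mulS; apply: eq_mulS => {}n; last exact: horner_expSX.
set F := addS _ _.
have FE : F =1 fun i => (addS (mulS (constS r) (expS 1)) (constS 1) i)%:P.
  move=> i; rewrite /F /addS polyCD -mulS_polyC -!constS_polyC.
  by congr (_ + _); apply: eq_mulS => j; rewrite ?constS_polyC -?expS_polyC.
have E2 : constS 2 =1 fun i => (constS 2 i : K)%:P.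
  by move=> i; rewrite -constS_polyC polyC_natr.
rewrite /divS (eq_mulS E2 (eq_invS FE)).
by rewrite (eq_mulS (frefl _) (invS_polyC _)) mulS_polyC hornerC.
Qed.

Lemma fact_neq0 n : [pchar K] =i pred0 -> (n`!%:R : K) != 0.
Proof. by move=> pchar0; rewrite ((pcharf0P K).1 pchar0) -lt0n fact_gt0. Qed.

(** Replacing [t] by [w t] in the generating function multiplies coefficient [k] by [w ^+ k] and
    turns e^(x t) into e^(w x t). *)
Lemma Euler_poly_dilS r x (w : K) k :
    [pchar K] =i pred0 ->
  (Euler_poly r k).[x] * w ^+ k / k`!%:R
  = mulS (dilS w (Euler_number_series r)) (expS (w * x)) k.
Proof.
move=> pchar0; rewrite -(eq_mulS (frefl _) (dilS_expS w x)) -dilSM /dilS.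
rewrite -horner_Euler_series.
rewrite /Euler_poly -polyC_natr hornerM hornerC.
by field; rewrite fact_neq0.
Qed.

(** This form exposes the symmetry: the [x_i] enter only through one exponent, and the [r_i] only
    through a commutative product. *)
Lemma sum_Euler_polyE (r1 r2 r3 x1 x2 x3 u1 u2 u3 : K) n :
    [pchar K] =i pred0 ->
  \sum_(k < n.+1) \sum_(l < n.+1) \sum_(m < n.+1 | (k + l + m == n)%N)
     n`!%:R / (k`!%:R * l`!%:R * m`!%:R)
     * (Euler_poly r1 k).[x1] * (Euler_poly r2 l).[x2] * (Euler_poly r3 m).[x3]
     * (u1 ^+ k * u2 ^+ l * u3 ^+ m)
  = n`!%:R * mulS (mulS (dilS u1 (Euler_number_series r1))
                    (mulS (dilS u2 (Euler_number_series r2))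
                          (dilS u3 (Euler_number_series r3))))
               (expS (u1 * x1 + (u2 * x2 + u3 * x3))) n.
Proof.
move=> pchar0.
have Ufact m : (m`!%:R : K) \is a GRing.unit by rewrite unitfE fact_neq0.
pose E r x u k := (Euler_poly r k).[x] * u ^+ k / k`!%:R.
transitivity (n`!%:R * mulS (E r1 x1 u1) (mulS (E r2 x2 u2) (E r3 x3 u3)) n).
  rewrite -mulS3E mulr_sumr; apply: eq_bigr => k _; rewrite mulr_sumr.
  apply: eq_bigr => l _; rewrite mulr_sumr; apply: eq_bigr => m _.
  by rewrite /E; field; rewrite !fact_neq0.
have EE r x u : E r x u =1 mulS (dilS u (Euler_number_series r)) (expS (u * x)).
  by move=> k; rewrite /E Euler_poly_dilS.
congr (_ * _).
rewrite (eq_mulS (EE _ _ _)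
           (eq_mulS (EE _ _ _) (EE _ _ _))).
(* Two exchanges move the three exponentials to the right of the three Euler factors. *)
rewrite (eq_mulS (frefl _) (mulSACA _ _ _ _)) mulSACA.
apply: eq_mulS => // i.
by rewrite (eq_mulS (frefl _) (mulS_expS _ _ Ufact)) mulS_expS.
Qed.

End EulerTheory.

(** Field morphisms are injective, so characteristic 0 passes from [rat] up the tower. *)
Lemma Cp_pchar0 (R : realType) (p : nat) (C : padic_complex R p) :
  [pchar Cp C] =i pred0.
Proof.
apply/pcharf0P => n.
rewrite -(rmorph_nat (Qpbar_Cp C)) fmorph_eq0 -(rmorph_nat (Qp_Qpbar C)).
by rewrite fmorph_eq0 -(rmorph_nat (rat_Qp C)) fmorph_eq0 pnatr_eq0.
Qed.

Theorem theorem4p16 (R : realType) (p : nat) (p_prime : prime p) (p_odd : odd p)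
    (C : padic_complex R p) (q : Cp C)
    (hq : Cp_abs (q - 1) < powR (p%:R : R) (- (1 / (p%:R - 1))))
    (w1 w2 w3 : nat) (hw1 : (0 < w1)%N) (hw2 : (0 < w2)%N) (hw3 : (0 < w3)%N)
    (n : nat) (y : Qp C) (hy : in_Zp y) :
  \sum_(k < n.+1) \sum_(l < n.+1) \sum_(m < n.+1 | (k + l + m == n)%N)
     n`!%:R / (k`!%:R * l`!%:R * m`!%:R)
     * (Euler_poly (q ^+ w3) k).[w1%:R * Qp_Cp y]
     * (Euler_poly (q ^+ w1) l).[w2%:R * Qp_Cp y]
     * (Euler_poly (q ^+ w2) m).[w3%:R * Qp_Cp y]
     * (w3%:R ^+ k * w1%:R ^+ l * w2%:R ^+ m)
  =
  \sum_(k < n.+1) \sum_(l < n.+1) \sum_(m < n.+1 | (k + l + m == n)%N)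
     n`!%:R / (k`!%:R * l`!%:R * m`!%:R)
     * (Euler_poly (q ^+ w2) k).[w1%:R * Qp_Cp y]
     * (Euler_poly (q ^+ w1) l).[w3%:R * Qp_Cp y]
     * (Euler_poly (q ^+ w3) m).[w2%:R * Qp_Cp y]
     * (w2%:R ^+ k * w1%:R ^+ l * w3%:R ^+ m).
Proof.
rewrite !sum_Euler_polyE; try exact: Cp_pchar0.
(* Both exponents equal (w1 w2 + w2 w3 + w3 w1) y. *)
congr (_ * _); have -> : w3%:R * (w1%:R * Qp_Cp y)
    + (w1%:R * (w2%:R * Qp_Cp y) + w2%:R * (w3%:R * Qp_Cp y))
  = w2%:R * (w1%:R * Qp_Cp y)
    + (w1%:R * (w3%:R * Qp_Cp y) + w3%:R * (w2%:R * Qp_Cp y)) by ring.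
(* The Euler factors come in the order w3, w1, w2 on the left and w2, w1, w3 on the right. *)
apply: eq_mulS => // i; rewrite mulSC mulSA.
by apply: eq_mulS => // j; rewrite mulSC.
Qed.
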